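(* Consider the two equations $AuA^{-1}=Bu'B^{-1}$ and $AvA^{-1}=Bv'B^{-1}$ in the free group $F_\Sigma$, where the unknowns $A,B$ range over the free monoid $M_\Sigma$, the words $u,u'$ are maximally cancelled with $|u|=|u'|\geq 0$, and $u,u',v,v'$ are non-negative with $|v|=|v'|$. Then the conjunction of the two equations is effectively equivalent either to one solved equation (of the form $As=B$ or $A=Bs$ with $s\in M_\Sigma$), or to a single equation of the form $AwA^{-1}=Bw'B^{-1}$ with $w,w'$ non-negative and $|w|=|w'|$, or it is contradictory.
   Context: $\Sigma$ is a set of generators, $M_\Sigma$ the free monoid over $\Sigma$ with neutral element $\epsilon$, and $F_\Sigma$ the free group: words over $\Sigma\cup\Sigma^-$ ($\Sigma^-=\{a^-\mid a\in\Sigma\}$ formal inverses) modulo the cancellation rules $aa^-=a^-a=\epsilon$; the inverse of $a_1\dots a_k$ is $a_k^{-1}\dots a_1^{-1}$. A word is maximally cancelled if no cancellation rule applies. The balance $|w|$ is the number of letters from $\Sigma$ minus the number of letters from $\Sigma^-$ in $w$; $w$ is non-negative if every prefix has non-negative balance. A conjunction is contradictory if no $(A,B)\in M_\Sigma^2$ satisfies it; equivalence means having the same solutions $(A,B)\in M_\Sigma^2$, and ''effectively'' means the equivalent form can be computed. *)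

(* Defs.v *)
From mathcomp Require Import all_boot all_order ssralg ssrnum ssrint.

Set Implicit Arguments.
Unset Strict Implicit.
Unset Printing Implicit Defensive.

(** * Words and the free group *)

(* [inl a] is the generator [a], [inr a] its formal inverse. *)
Definition letter (S : eqType) : Type := (S + S)%type.
Definition word (S : eqType) : Type := seq (letter S).

Definition emb (S : eqType) (A : seq S) : word S := [seq inl a | a <- A].

Definition linv (S : eqType) (x : letter S) : letter S :=
  match x with inl a => inr a | inr a => inl a end.

Definition winv (S : eqType) (w : word S) : word S :=
  rev [seq linv x | x <- w].

Inductive cancels (S : eqType) : word S -> word S -> Prop :=
| cancel_pos (x y : word S) (a : S) :
    cancels (x ++ [:: inl a; inr a] ++ y) (x ++ y)
| cancel_neg (x y : word S) (a : S) :
    cancels (x ++ [:: inr a; inl a] ++ y) (x ++ y).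

(* Equality in the free group: the equivalence relation generated by the
   cancellation rules. *)
Inductive fg_eq (S : eqType) : word S -> word S -> Prop :=
| fg_step (x y : word S) : cancels x y -> fg_eq x y
| fg_refl (x : word S) : fg_eq x x
| fg_sym (x y : word S) : fg_eq x y -> fg_eq y x
| fg_trans (x y z : word S) : fg_eq x y -> fg_eq y z -> fg_eq x z.

Definition maximally_cancelled (S : eqType) (w : word S) : Prop :=
  forall w' : word S, ~ cancels w w'.

Definition is_pos (S : eqType) (x : letter S) : bool :=
  match x with inl _ => true | inr _ => false end.

Definition balance (S : eqType) (w : word S) : int :=
  (Posz (count (@is_pos S) w) - Posz (count (predC (@is_pos S)) w))%R.

Definition nonneg_word (S : eqType) (w : word S) : Prop :=
  forall p q : word S, w = p ++ q -> (0 <= balance p)%R.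

(* The equation [A w A^-1 = B w' B^-1], for [A], [B] in the free monoid. *)
Definition conj_eq (S : eqType) (w w' : word S) (A B : seq S) : Prop :=
  fg_eq (emb A ++ w ++ winv (emb A)) (emb B ++ w' ++ winv (emb B)).

(** * The possible equivalent forms *)

Inductive equiv_form (S : eqType) : Type :=
| SolvedB of seq S
| SolvedA of seq S
| Single of word S & word S
| Contradictory.

Arguments Contradictory {S}.

Definition admissible (S : eqType) (o : equiv_form S) : Prop :=
  match o with
  | Single w w' =>
      [/\ nonneg_word w, nonneg_word w' & balance w = balance w']
  | _ => True
  end.

Definition satisfies (S : eqType) (o : equiv_form S) (A B : seq S) : Prop :=
  match o with
  | SolvedB s => A ++ s = B
  | SolvedA s => A = B ++ s
  | Single w w' => conj_eq w w' A B
  | Contradictory => False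
  end.

Definition equiv_form_code (S : eqType) (o : equiv_form S) :
    (seq S + seq S) + (word S * word S + unit) :=
  match o with
  | SolvedB s => inl (inl s)
  | SolvedA s => inl (inr s)
  | Single w w' => inr (inl (w, w'))
  | Contradictory => inr (inr tt)
  end.

(** * Effectiveness *)

(* The total recursive functions on the data types built from [S], [unit],
   [bool], [nat] by products, sums and lists: structural operations, iteration
   over numbers and lists, and Kleene minimization of total predicates.  The
   generators are abstract atoms, on which the only primitive is the equality
   test; no constant of type [S] is available.  When [S] is finite this is
   ordinary computability.  In rules with a parameter, the parameter is the
   first component of the argument. *)
Inductive computable (S : eqType) : forall A B : Type, (A -> B) -> Prop :=
| c_ext (A B : Type) (f g : A -> B) :
    computable S f -> f =1 g -> computable S g
| c_id (A : Type) : computable S (fun x : A => x)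
| c_comp (A B C : Type) (g : B -> C) (f : A -> B) :
    computable S g -> computable S f -> computable S (fun x => g (f x))
| c_eq : computable S (fun x : S * S => x.1 == x.2)
| c_unit (A : Type) : computable S (fun _ : A => tt)
| c_pair (A B C : Type) (f : A -> B) (g : A -> C) :
    computable S f -> computable S g -> computable S (fun x => (f x, g x))
| c_fst (A B : Type) : computable S (fun x : A * B => x.1)
| c_snd (A B : Type) : computable S (fun x : A * B => x.2)
| c_inl (A B : Type) : computable S (fun x : A => inl x : A + B)
| c_inr (A B : Type) : computable S (fun x : B => inr x : A + B)
| c_case (P A B C : Type) (f : P * A -> C) (g : P * B -> C) :
    computable S f -> computable S g ->
    computable S (fun x : P * (A + B) =>
      match x.2 with inl a => f (x.1, a) | inr b => g (x.1, b) end)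
| c_bool (A : Type) (b : bool) : computable S (fun _ : A => b)
| c_if (A B : Type) (c : A -> bool) (f g : A -> B) :
    computable S c -> computable S f -> computable S g ->
    computable S (fun x => if c x then f x else g x)
| c_zero (A : Type) : computable S (fun _ : A => 0%N)
| c_succ : computable S (fun n : nat => n.+1)
| c_iter (P A : Type) (f : P * A -> A) :
    computable S f ->
    computable S (fun x : P * (A * nat) =>
      iter x.2.2 (fun a => f (x.1, a)) x.2.1)
| c_nil (A B : Type) : computable S (fun _ : A => [::] : seq B)
| c_cons (A : Type) : computable S (fun x : A * seq A => x.1 :: x.2)
| c_foldr (P A B : Type) (f : P * (A * B) -> B) :
    computable S f ->
    computable S (fun x : P * (B * seq A) =>
      foldr (fun a b => f (x.1, (a, b))) x.2.1 x.2.2)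
| c_min (A : Type) (p : A * nat -> bool) (g : A -> nat) :
    computable S p ->
    (forall x, p (x, g x)) ->
    (forall x n, p (x, n) -> g x <= n) ->
    computable S g.

(* Main.v *)
Require Import Defs.
From mathcomp Require Import all_boot all_order ssralg ssrnum ssrint.
From mathcomp Require Import zify.

Set Implicit Arguments.
Unset Strict Implicit.
Unset Printing Implicit Defensive.

(* Only [g = B^-1 A] matters: the equations say [g u g^-1 = u'] and
   [g v g^-1 = v']. If [u] is trivial, the first equation is trivial or
   unsolvable. Otherwise, as [u] and [u'] are non-negative, the reduced form of
   [A u A^-1 = B u' B^-1] starts with the first letters of both [A] and [B] after
   a common prefix is removed; hence one of [A], [B] is a prefix of the other, and
   up to symmetry [g] is a positive word [q].

   Since [q u] is reduced, [q u = u' q] makes [q] a prefix of [u'] unless [u] is a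
   positive suffix of [q]. If [u] and [v] commute, such suffixes can be stripped,
   and all solutions of the first equation solve the second one as soon as one of
   them does. If they do not commute, there is at most one [g], and it is found
   among the prefixes of [u' v'] and [v' u']. Both uniqueness claims rest on the
   fact that a non-negative word commuting with a nonempty positive word is
   positive, so that commutation is transitive as in the free monoid. *)

(** * Normal forms in the free group *)

Definition push (S : eqType) (x : letter S) (w : word S) : word S :=
  if w is y :: t then if y == linv x then t else x :: w else [:: x].

Definition red (S : eqType) (w : word S) : word S :=
  foldr (fun x t => push x t) [::] w.

Definition reduced (S : eqType) (w : word S) : bool :=
  sorted (fun x y : letter S => y != linv x) w.

Lemma linvK (S : eqType) : involutive (@linv S).
Proof. by case. Qed.

Lemma push_reduced (S : eqType) (x : letter S) (w : word S) :
  reduced w -> reduced (push x w).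
Proof.
case: w => [//|y t] /= Ht; case: eqP => [_|/eqP Hy].
  exact: path_sorted Ht.
by rewrite /reduced /= Hy.
Qed.

(** Letters act on reduced words by [push], and [x] undoes [linv x], so the free group acts on
    normal forms. Reducedness ensures that once a head [x] is removed, the tail does not start with
    [linv x]. *)
Lemma pushK (S : eqType) (x : letter S) (w : word S) :
  reduced w -> push x (push (linv x) w) = w.
Proof.
case: w => [|y t] /=; first by rewrite eqxx.
rewrite linvK; case: eqP => [-> |_ _] /=; last by rewrite eqxx.
by case: t => [//|z t] /= /andP[/negPf -> _].
Qed.

Lemma red_reduced (S : eqType) (w : word S) : reduced (red w).
Proof. by elim: w => // x w IH; apply: push_reduced. Qed.

Lemma red_id (S : eqType) (w : word S) : reduced w -> red w = w.
Proof.
elim: w => //= x w IH Hw; rewrite -/(red w) IH; last exact: path_sorted Hw.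
by case: w Hw {IH} => [//|y t] /= /andP[/negPf -> _].
Qed.

(** The action of [x] depends only on [red x]: where [red] drops a pair of inverse letters, [pushK]
    makes this pair act trivially. *)
Lemma foldr_push_red (S : eqType) (x w : word S) :
  reduced w ->
  foldr (fun x t => push x t) w (red x) = foldr (fun x t => push x t) w x.
Proof.
move=> Hw.
have Hr y : reduced (foldr (fun x t => push x t) w y).
  by elim: y => //= a y; apply: push_reduced.
elim: x => //= a x <-; rewrite -/(red x).
case: (red x) => [//|y t] /=; case: eqP => [-> |//].
by rewrite pushK.
Qed.

Lemma red_catr (S : eqType) (x y : word S) : red (x ++ red y) = red (x ++ y).
Proof. by rewrite /red !foldr_cat -/(red y) -/(red (red y)) red_id ?red_reduced. Qed.

Lemma red_catl (S : eqType) (x y : word S) : red (red x ++ y) = red (x ++ y).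
Proof. by rewrite /red !foldr_cat foldr_push_red // red_reduced. Qed.

Lemma red_idem (S : eqType) (x : word S) : red (red x) = red x.
Proof. by rewrite red_id ?red_reduced. Qed.

Lemma red_congrl (S : eqType) (l x y : word S) :
  red x = red y -> red (l ++ x) = red (l ++ y).
Proof. by move=> H; rewrite -red_catr H red_catr. Qed.

Lemma red_congrr (S : eqType) (r x y : word S) :
  red x = red y -> red (x ++ r) = red (y ++ r).
Proof. by move=> H; rewrite -red_catl H red_catl. Qed.

Lemma red_linv (S : eqType) (x : letter S) (w : word S) :
  red (x :: linv x :: w) = red w.
Proof. exact: pushK (red_reduced w). Qed.

Lemma winv_cons (S : eqType) (x : letter S) (w : word S) :
  winv (x :: w) = winv w ++ [:: linv x].
Proof. by rewrite /winv /= rev_cons cats1. Qed.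

Lemma winv_cat (S : eqType) (x y : word S) : winv (x ++ y) = winv y ++ winv x.
Proof. by rewrite /winv map_cat rev_cat. Qed.

Lemma red_mulV (S : eqType) (x y : word S) : red (x ++ winv x ++ y) = red y.
Proof.
elim: x y => [//|a x IH] y.
rewrite winv_cons -catA -[RHS](red_linv a) /=.
by rewrite -/(red (x ++ winv x ++ linv a :: y)) IH.
Qed.

Lemma winvK (S : eqType) : involutive (@winv S).
Proof.
move=> x; rewrite /winv map_rev revK -map_comp.
by rewrite (eq_map (g := id)) ?map_id //; apply: linvK.
Qed.

Lemma red_mulNV (S : eqType) (x y : word S) : red (winv x ++ x ++ y) = red y.
Proof. by rewrite -{2}(winvK x) red_mulV. Qed.

Lemma red_cancell (S : eqType) (l x y : word S) :
  red (l ++ x) = red (l ++ y) -> red x = red y.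
Proof. by move=> /(red_congrl (winv l)); rewrite !red_mulNV. Qed.

Lemma red_cancelr (S : eqType) (r x y : word S) :
  red (x ++ r) = red (y ++ r) -> red x = red y.
Proof.
move=> /(red_congrr (winv r)); rewrite -!catA.
have E w : red (w ++ r ++ winv r) = red w.
  by rewrite -[X in _ ++ r ++ X]cats0 -red_catr red_mulV red_catr cats0.
by rewrite !E.
Qed.

Lemma cancels_linv (S : eqType) (x y : word S) (l : letter S) :
  cancels (x ++ [:: l; linv l] ++ y) (x ++ y).
Proof. by case: l => a; [apply: cancel_pos | apply: cancel_neg]. Qed.

Lemma fg_eq_cons (S : eqType) (l : letter S) (x y : word S) :
  fg_eq x y -> fg_eq (l :: x) (l :: y).
Proof.
elim=> [a b [u v c|u v c]|a|a b _ H|a b c _ H1 _ H2].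
- by apply: fg_step; apply: (cancel_pos (l :: u)).
- by apply: fg_step; apply: (cancel_neg (l :: u)).
- exact: fg_refl.
- exact: fg_sym.
- exact: fg_trans H1 H2.
Qed.

Lemma fg_eq_red (S : eqType) (w : word S) : fg_eq w (red w).
Proof.
elim: w => [|x w IH]; first exact: fg_refl.
apply: fg_trans (fg_eq_cons x IH) _ => /=; rewrite -/(red w).
case: (red w) => [|y t]; first exact: fg_refl.
rewrite /push; case: eqP => [-> |_]; last exact: fg_refl.
by apply: fg_step; apply: (cancels_linv [::]).
Qed.

(** A cancelling pair acts trivially, so [red] is constant on classes; conversely [red] is reached
    by cancellations. *)
Lemma fg_eqP (S : eqType) (x y : word S) : fg_eq x y <-> red x = red y.
Proof.
split; last first.
  by move=> E; apply: fg_trans (fg_eq_red x) _; rewrite E; apply/fg_sym/fg_eq_red.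
elim=> [a b [u v c|u v c]|//|//|a b c _ -> _ -> //].
  by apply: red_congrl; apply: (red_linv (inl c)).
by apply: red_congrl; apply: (red_linv (inr c)).
Qed.

Lemma maximally_cancelled_reduced (S : eqType) (w : word S) :
  maximally_cancelled w -> reduced w.
Proof.
elim: w => [//|x w IH] Hw; have {}IH : reduced w.
  apply: IH => w' C; apply: (Hw (x :: w')).
  by case: C => u v c; [apply: (cancel_pos (x :: u)) | apply: (cancel_neg (x :: u))].
case: w Hw IH => [//|y t] Hw; rewrite /reduced /= => ->; rewrite andbT.
by apply/eqP => E; apply: (Hw t); rewrite E; apply: (cancels_linv [::]).
Qed.

Lemma size_push (S : eqType) (x : letter S) (w : word S) :
  size (push x w) <= (size w).+1 /\
  (size (push x w) = (size w).+1 -> push x w = x :: w).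
Proof. by case: w => [//|y t] /=; case: eqP => _ //=; split=> //; lia. Qed.

(** Every cancellation shortens the word, so equal lengths certify that none took place. This turns
    identities between normal forms into identities between words. *)
Lemma size_red (S : eqType) (w : word S) :
  size (red w) <= size w /\ (size (red w) = size w -> red w = w).
Proof.
elim: w => [//|x w [IH1 IH2]] /=; rewrite -/(red w).
have [P1 P2] := size_push x (red w).
split; first exact: leq_trans P1 _.
move=> E; have Es : size (red w) = size w.
  by apply/eqP; rewrite eqn_leq IH1 /= -ltnS -E.
by rewrite P2 ?Es // IH2.
Qed.

(** Cancellation happens only at the junction: [c] is the part of [y] cancelled by the end of
    [x]. *)
Lemma red_cat_split (S : eqType) (x y : word S) :
  reduced x -> reduced y ->
  exists a c d, [/\ x = a ++ winv c, y = c ++ d & red (x ++ y) = a ++ d].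
Proof.
elim: x => [|l x IH] Hx Hy; first by exists [::], [::], y; rewrite red_id.
have [a [c [d [Ex Ey Er]]]] := IH (path_sorted Hx) Hy.
rewrite /= -/(red (x ++ y)) Er.
(* The new letter [l] can cancel only if all of [x] has been consumed; otherwise it meets [m], its
   neighbour in the reduced word [l :: x]. *)
case: a Ex Er => [|m a] Ex Er.
  case: d Ey Er => [|m d] Ey Er /=.
    by exists [:: l], c, [::]; rewrite Ex.
  case: eqP => [Em|_]; last by exists [:: l], c, (m :: d); rewrite Ex.
  exists [::], (c ++ [:: m]), d; rewrite -catA winv_cat winv_cons Ex Em linvK.
  by split=> //=; rewrite Ey Em.
exists (l :: m :: a), c, d; rewrite Ex /=; split=> //.
by move: Hx; rewrite Ex /reduced /= => /andP[/negPf ->].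
Qed.

(** * Conjugation *)

(* [q u q^-1 = u'] in the free group, stated without inverses. *)
Definition conjugates (S : eqType) (q u u' : word S) : Prop :=
  red (q ++ u) = red (u' ++ q).

Lemma conjugates_nil (S : eqType) (u u' : word S) :
  conjugates [::] u u' <-> red u = red u'.
Proof. by rewrite /conjugates cats0. Qed.

Lemma conjugates_red (S : eqType) (q q' u w u' w' : word S) :
  red q = red q' -> red u = red w -> red u' = red w' ->
  conjugates q u u' -> conjugates q' w w'.
Proof.
rewrite /conjugates => Eq Eu Eu' H.
by rewrite -(red_congrr w Eq) -(red_congrl q Eu) H (red_congrr q Eu')
  (red_congrl w' Eq).
Qed.

Lemma conjugates_mul (S : eqType) (q u u' v v' : word S) :
  conjugates q u u' -> conjugates q v v' -> conjugates q (u ++ v) (u' ++ v').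
Proof.
rewrite /conjugates => Hu Hv.
by rewrite catA (red_congrr v Hu) -!catA (red_congrl u' Hv).
Qed.

(** With the next two lemmas, this forms a two-out-of-three rule for conjugation by [q], [p] and
    [p ++ q]. *)
Lemma conjugates_comp (S : eqType) (p q u u' u'' : word S) :
  conjugates q u u' -> conjugates p u' u'' -> conjugates (p ++ q) u u''.
Proof.
rewrite /conjugates => Hq Hp.
by rewrite -catA (red_congrl p Hq) !catA (red_congrr q Hp).
Qed.

Lemma conjugates_catl (S : eqType) (p q u u' u'' : word S) :
  conjugates (p ++ q) u u'' -> conjugates q u u' -> conjugates p u' u''.
Proof.
rewrite /conjugates => Hpq Hq; apply: (red_cancelr (r := q)).
by rewrite -!catA -(red_congrl p Hq) catA Hpq.
Qed.

Lemma conjugates_catr (S : eqType) (p q u u' u'' : word S) :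
  conjugates (p ++ q) u u'' -> conjugates p u' u'' -> conjugates q u u'.
Proof.
rewrite /conjugates => Hpq Hp; apply: (red_cancell (l := p)).
by rewrite catA Hpq !catA (red_congrr q Hp).
Qed.

Lemma conjugates_uniq (S : eqType) (q u u' u'' : word S) :
  conjugates q u u' -> conjugates q u u'' -> red u' = red u''.
Proof. by rewrite /conjugates => -> /red_cancelr. Qed.

(** As [q ++ winv q] acts trivially, both directions are instances of the two-out-of-three rule. *)
Lemma conjugates_inv (S : eqType) (q u u' : word S) :
  conjugates (winv q) u u' <-> conjugates q u' u.
Proof.
have E : red [::] = red (q ++ winv q) by rewrite -[winv q]cats0 red_mulV.
have I w : conjugates (q ++ winv q) w w.
  by apply: conjugates_red E (erefl _) (erefl _) _; apply/conjugates_nil.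
by split=> H; [apply: conjugates_catl (I _) H | apply: conjugates_catr (I _) H].
Qed.

(** Commutation of [u] and [v] is written [conjugates u v v]. Conjugation by [q] carries [u v] to
    [u' v'] and [v u] to [v' u'], and images are unique. *)
Lemma conjugates_commute (S : eqType) (q u u' v v' : word S) :
  conjugates q u u' -> conjugates q v v' ->
  conjugates u v v -> conjugates u' v' v'.
Proof.
move=> Hu Hv C; apply: (conjugates_uniq (conjugates_mul Hu Hv)).
exact: conjugates_red (erefl _) (esym C) (erefl _) (conjugates_mul Hv Hu).
Qed.

Lemma conjugates_winv (S : eqType) (q u : word S) :
  conjugates q u (q ++ u ++ winv q).
Proof.
rewrite /conjugates -!catA; apply: red_congrl.
rewrite -{1}[u]cats0; apply: red_congrl.
by rewrite -[X in winv q ++ X]cats0 red_mulNV.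
Qed.

Lemma conj_eqP (S : eqType) (w w' : word S) (A B : seq S) :
  conj_eq w w' A B <-> conjugates (winv (emb B) ++ emb A) w w'.
Proof.
rewrite /conj_eq fg_eqP.
have HA := conjugates_winv (emb A) w; have HB := conjugates_winv (emb B) w'.
split=> [E|H].
  apply: conjugates_comp HA _; apply/conjugates_inv.
  exact: conjugates_red (erefl _) (erefl _) (esym E) HB.
apply: conjugates_uniq HA _.
apply: conjugates_red (red_mulV (emb B) (emb A)) (erefl _) (erefl _) _.
exact: conjugates_comp H HB.
Qed.

(** If [B] is a prefix of [A], the conjugator is a positive word; [conj_eq_sym] transfers this to
    the case where [A] is a prefix of [B]. *)
Lemma conj_eq_catl (S : eqType) (w w' : word S) (B q : seq S) :
  conj_eq w w' (B ++ q) B <-> conjugates (emb q) w w'.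
Proof.
have E : red (winv (emb B) ++ emb (B ++ q)) = red (emb q).
  by rewrite /emb map_cat red_mulNV.
by rewrite conj_eqP; split; apply: conjugates_red.
Qed.

Lemma conj_eq_sym (S : eqType) (w w' : word S) (A B : seq S) :
  conj_eq w w' A B <-> conj_eq w' w B A.
Proof. by rewrite /conj_eq; split=> H; apply: fg_sym. Qed.

(** * Non-negative words *)

Lemma emb_cat (S : eqType) (p q : seq S) : emb (p ++ q) = emb p ++ emb q.
Proof. exact: map_cat. Qed.

Lemma emb_inj (S : eqType) : injective (@emb S).
Proof. by apply: inj_map => a b []. Qed.

Lemma emb_eq_cat (S : eqType) (q : seq S) (x y : word S) :
  emb q = x ++ y -> exists p r, [/\ q = p ++ r, x = emb p & y = emb r].
Proof.
move=> E; exists (take (size x) q), (drop (size x) q).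
by rewrite cat_take_drop /emb map_take map_drop -/(emb q) E take_size_cat
  ?drop_size_cat.
Qed.

Lemma balance_cons (S : eqType) (x : letter S) (w : word S) :
  balance (x :: w) = (balance [:: x] + balance w)%R.
Proof. by rewrite /balance /=; lia. Qed.

Lemma balance_cat (S : eqType) (x y : word S) :
  balance (x ++ y) = (balance x + balance y)%R.
Proof. by rewrite /balance !count_cat; lia. Qed.

Lemma balance_linv (S : eqType) (x : letter S) :
  balance [:: linv x] = (- balance [:: x])%R.
Proof. by case: x. Qed.

Lemma balance_red (S : eqType) (w : word S) : balance (red w) = balance w.
Proof.
elim: w => //= x w IH; rewrite -/(red w) balance_cons -IH.
case: (red w) => [|y t] /=; first by rewrite GRing.addr0.
case: eqP => [->|_]; last by rewrite balance_cons.
by rewrite (balance_cons _ t) balance_linv; lia.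
Qed.

Lemma balance_emb (S : eqType) (q : seq S) : balance (emb q) = Posz (size q).
Proof.
elim: q => // a q; rewrite [emb _]/= balance_cons -/(emb q) => ->.
by rewrite /balance /=; lia.
Qed.

(* Counting the balance from [k] makes non-negativity structurally recursive. *)
Fixpoint nonneg_from (S : eqType) (k : int) (w : word S) : bool :=
  (0 <= k)%R && (if w is x :: t then nonneg_from (k + balance [:: x])%R t
                 else true).

Lemma nonneg_fromP (S : eqType) (k : int) (w : word S) :
  (forall p q, w = p ++ q -> (0 <= k + balance p)%R) <-> nonneg_from k w.
Proof.
elim: w k => [|x w IH] k.
  rewrite /= andbT; split=> [/(_ [::] [::] (erefl _))|H [|//] _ _];
    by rewrite /balance /=; lia.
split=> [H|/= /andP[Hk /IH H] [|y p] q].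
- apply/andP; split; first by have := H [::] _ (erefl _); rewrite /balance /=; lia.
  apply/IH => p q E; have := H (x :: p) q; rewrite E balance_cons => /(_ (erefl _)).
  by lia.
- by rewrite /balance /=; lia.
- by case=> <- /H; rewrite (balance_cons _ p); lia.
Qed.

Lemma nonneg_fromE (S : eqType) (w : word S) :
  nonneg_word w <-> nonneg_from 0 w.
Proof.
rewrite -nonneg_fromP /nonneg_word.
by split=> H p q /H; rewrite GRing.add0r.
Qed.

(** Cancelling a pair of inverse letters only removes values from the sequence of prefix balances.
    The induction covers all starting values [k], as the tail is read from a shifted count. *)
Lemma nonneg_red (S : eqType) (w : word S) : nonneg_word w -> nonneg_word (red w).
Proof.
rewrite !nonneg_fromE; elim: w 0%R => //= x w IH k; rewrite -/(red w).
move=> /andP[Hk /IH]; case: (red w) => [|y t] /=; first by move=> ->; rewrite Hk.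
case: eqP => [-> /andP[_]|_ H] /=; last by rewrite Hk.
by rewrite balance_linv GRing.addrK.
Qed.

Lemma nonneg_catl (S : eqType) (x y : word S) :
  nonneg_word (x ++ y) -> nonneg_word x.
Proof. by move=> H p q E; apply: (H p (q ++ y)); rewrite E catA. Qed.

Lemma cat_eq_cat (T : Type) (x y p q : seq T) :
  x ++ y = p ++ q ->
  (exists r, x = p ++ r /\ q = r ++ y) \/ (exists r, p = x ++ r /\ y = r ++ q).
Proof.
elim: x p => [|a x IH] [|b p] /= E.
- by left; exists [::].
- by right; exists (b :: p).
- by left; exists (a :: x).
- case: E => <- /IH[[r [-> ->]]|[r [-> ->]]]; [left | right]; by exists r.
Qed.

Lemma nonneg_cat (S : eqType) (x y : word S) :
  nonneg_word x -> nonneg_word y -> nonneg_word (x ++ y).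
Proof.
move=> Hx Hy p q /cat_eq_cat[[r [E _]]|[r [-> E]]]; first exact: Hx E.
have := Hx x [::]; rewrite cats0 balance_cat => /(_ (erefl _)).
by have := Hy r q E; lia.
Qed.

(** A non-negative word cannot begin with an inverse letter, so nothing cancels at the junction. *)
Lemma emb_cat_reduced (S : eqType) (q : seq S) (u : word S) :
  reduced u -> nonneg_word u -> reduced (emb q ++ u).
Proof.
move=> Hu Nu; elim: q => //= a q IH; rewrite -/(emb q).
case: q IH => [_|b q /= IH] /=; last exact: IH.
case: u Hu Nu => [//|[b|b] t] Hu Nu; first exact: Hu.
by have := Nu [:: inr b] t (erefl _).
Qed.

Lemma emb_reduced (S : eqType) (q : seq S) : reduced (emb q).
Proof. by rewrite -[emb q]cats0 emb_cat_reduced // => -[|//] [|//]. Qed.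

Lemma conjugates_emb (S : eqType) (q u v : seq S) :
  conjugates (emb q) (emb u) (emb v) <-> q ++ u = v ++ q.
Proof.
rewrite /conjugates -!emb_cat !red_id ?emb_reduced //.
by split=> [/emb_inj|->].
Qed.

(* The word [q u] is reduced, so cancelling [u' q] = [a c^-1 c d] identifies
   [q u] with [a d]. *)
Lemma conjugates_split (S : eqType) (q : seq S) (u u' : word S) :
  reduced u -> nonneg_word u -> reduced u' -> conjugates (emb q) u u' ->
  exists a c d, [/\ u' = a ++ winv c, emb q = c ++ d & emb q ++ u = a ++ d].
Proof.
move=> Hu Nu Hu' H.
have [a [c [d [E1 E2 E3]]]] := red_cat_split Hu' (emb_reduced q).
by exists a, c, d; rewrite -E3 -H red_id // emb_cat_reduced.
Qed.

(** In [q u = a d], either [a] extends [q], and then [u'] starts with [q], or [u] is a suffix of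
    [d], hence of [q]. *)
Lemma conjugates_prefix (S : eqType) (q : seq S) (u u' : word S) :
  reduced u -> nonneg_word u -> reduced u' -> conjugates (emb q) u u' ->
  (exists t, u' = emb q ++ t) \/ (exists q1 u0, q = q1 ++ u0 /\ u = emb u0).
Proof.
move=> Hu Nu Hu' H; have [a [c [d [E1 E2 E3]]]] := conjugates_split Hu Nu Hu' H.
case: (cat_eq_cat E3) => [[r [_ Ed]]|[r [Ea _]]]; last first.
  by left; exists (r ++ winv c); rewrite E1 Ea catA.
right; move: E2; rewrite Ed catA => /emb_eq_cat[q1 [u0 [-> _ ->]]].
by exists q1, u0.
Qed.

(** In the factorization of [conjugates_split], an empty [a] would make [d] the conjugator followed
    by the nonempty [u], although [d] is a suffix of the conjugator. So [a] starts with [b]. *)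
Lemma conjugates_head (S : eqType) (b : S) (q : seq S) (u w : word S) :
  u <> [::] -> reduced u -> nonneg_word u -> reduced w ->
  conjugates (emb (b :: q)) u w -> exists t, w = inl b :: t.
Proof.
move=> U0 Hu Nu Hw H; have [a [c [d [-> E2 E3]]]] := conjugates_split Hu Nu Hw H.
case: a E3 => [|x a] E3; last by case: E3 => <- _; exists (a ++ winv c).
have := congr1 size E2; have := congr1 size E3; rewrite !size_cat /=.
by case: u U0 {Hu Nu H E3} => //= *; lia.
Qed.

Lemma conjugates_comparable (S : eqType) (p q : seq S) (u u' : word S) :
  u <> [::] -> reduced u -> nonneg_word u -> reduced u' -> nonneg_word u' ->
  conjugates (winv (emb p) ++ emb q) u u' ->
  (exists h, q = p ++ h) \/ (exists h, p = q ++ h).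
Proof.
move=> U0 Hu Nu Hu' Nu'; elim: p q => [|a p IH] q; first by left; exists q.
case: q => [|b q]; first by right; exists (a :: p).
have [<-|Hab] := eqVneq a b => H.
  have /IH[[h ->]|[h ->]] : conjugates (winv (emb p) ++ emb q) u u'.
  - apply: conjugates_red H => //; rewrite winv_cons -catA.
    exact/red_congrl/(red_linv (inr a)).
  - by left; exists h.
  - by right; exists h.
(* At differing letters, [w] is the normal form of the common conjugate of [u] by [b :: q] and of
   [u'] by [a :: p]; it would have to start with both letters. *)
have [w [Hw Hq]] : exists w, reduced w /\ conjugates (emb (b :: q)) u w.
  exists (red (emb (b :: q) ++ u ++ winv (emb (b :: q)))); split.
    exact: red_reduced.
  exact: conjugates_red (erefl _) (erefl _) (esym (red_idem _)) (conjugates_winv _ _).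
have Hp : conjugates (emb (a :: p)) u' w.
  apply: conjugates_catl H; apply: conjugates_red Hq => //.
  by rewrite red_mulV.
have [t Et] := conjugates_head U0 Hu Nu Hw Hq.
have [U0'|/eqP U0'] := eqVneq u' [::].
  move: Hp; rewrite U0' /conjugates cats0 => /(red_cancelr (x := [::])).
  by rewrite (red_id Hw) Et.
have [t'] := conjugates_head U0' Hu' Nu' Hw Hp.
by rewrite Et => -[E]; rewrite E eqxx in Hab.
Qed.

(** * Commutation *)

(* Words commuting with [u] are prefixes of the powers of [u], hence [x y] and
   [y x] are prefixes of the same word. *)
Lemma commute_trans (T : Type) (u x y : seq T) :
  u <> [::] -> x ++ u = u ++ x -> y ++ u = u ++ y -> x ++ y = y ++ x.
Proof.
move=> U0 Hx Hy; pose n := size (x ++ y); pose p := flatten (nseq n u).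
have Hp z : z ++ u = u ++ z -> size z = n -> z = take n p.
  move=> Hz Sz.
  have Hzp : z ++ p = p ++ z.
    rewrite /p; elim: (n) => [|m IH] /=; first by rewrite cats0.
    by rewrite catA Hz -!catA IH.
  have Sp : n <= size p.
    rewrite size_flatten /shape map_nseq sumn_nseq.
    by apply: leq_pmull; case: (u) U0.
  by rewrite -[LHS](take_size_cat p Sz) Hzp takel_cat.
have Cxy : (x ++ y) ++ u = u ++ x ++ y by rewrite -catA Hy !catA Hx.
have Cyx : (y ++ x) ++ u = u ++ y ++ x by rewrite -catA Hx !catA Hy.
by rewrite (Hp _ Cxy) // (Hp _ Cyx) // /n !size_cat addnC.
Qed.

(** Unless [u] is a positive suffix of [c], it factors as [c t] with [t] commuting with [c], so also
    as [t c]. As a suffix of [u], [t] is reduced; as a prefix, it is non-negative; so the induction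
    applies to [t]. *)
Lemma commute_pos (S : eqType) (c : seq S) (u : word S) :
  c <> [::] -> reduced u -> nonneg_word u -> conjugates (emb c) u u ->
  exists u0, u = emb u0.
Proof.
move=> C0; have [n] := ubnP (size u); elim: n u => // n IH u Hn Hu Nu H.
have [[t Et]|[q1 [u0 [_ ->]]]] := conjugates_prefix Hu Nu Hu H; last by exists u0.
have Ht : conjugates (emb c) t t.
  by apply: (red_cancell (l := emb c)); move: H; rewrite Et /conjugates -!catA.
(* [t c] has normal form [u] and the same length as [u = c t], so it is already reduced. *)
have Eu : u = t ++ emb c.
  have E : red (t ++ emb c) = u by rewrite -Ht -Et red_id.
  rewrite -[LHS]E (proj2 (size_red _)) // E Et !size_cat; exact: addnC.
have St : size t < n.
  apply: leq_trans (_ : size t < size u) _; last by rewrite -ltnS.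
  by rewrite Eu size_cat size_map -[X in X < _]addn0 ltn_add2l; case: (c) C0.
have [] := IH t St _ _ Ht; last by move=> t0 Et0; exists (c ++ t0); rewrite emb_cat -Et0.
  by move: Hu; rewrite Et => /cat_sorted2[].
by move: Nu; rewrite Eu => /nonneg_catl.
Qed.

(** For nonempty [c], [commute_pos] makes first [u], then the normal form of [v], positive, which
    leaves [commute_trans] in the free monoid. *)
Lemma conjugates_trans (S : eqType) (c : seq S) (u v : word S) :
  u <> [::] -> reduced u -> nonneg_word u -> nonneg_word v ->
  conjugates (emb c) u u -> conjugates u v v -> conjugates (emb c) v v.
Proof.
move=> U0 Hu Nu Nv Hc Hv; have [->|/eqP C0] := eqVneq c [::].
  exact/conjugates_nil.
have [u0 Eu] := commute_pos C0 Hu Nu Hc; rewrite {u}Eu in U0 Hu Nu Hc Hv.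
have {}U0 : u0 <> [::] by move=> E; rewrite E in U0.
have {}Hv := conjugates_red (erefl _) (esym (red_idem v)) (esym (red_idem v)) Hv.
have [v0 Ev] := commute_pos U0 (red_reduced v) (nonneg_red Nv) Hv.
apply: (conjugates_red (erefl _) (red_idem v) (red_idem v)).
move: Hc Hv; rewrite Ev => /conjugates_emb Hc /conjugates_emb Hv.
by apply/conjugates_emb/(commute_trans U0) => //; rewrite Hv.
Qed.

Lemma conjugates_trans_pos (S : eqType) (c : seq S) (u v : word S) :
  c <> [::] -> nonneg_word u -> nonneg_word v ->
  conjugates (emb c) u u -> conjugates (emb c) v v -> conjugates u v v.
Proof.
move=> C0 Nu Nv Hu Hv.
have {}Hu := conjugates_red (erefl _) (esym (red_idem u)) (esym (red_idem u)) Hu.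
have {}Hv := conjugates_red (erefl _) (esym (red_idem v)) (esym (red_idem v)) Hv.
have [u0 Eu] := commute_pos C0 (red_reduced u) (nonneg_red Nu) Hu.
have [v0 Ev] := commute_pos C0 (red_reduced v) (nonneg_red Nv) Hv.
apply: (conjugates_red (red_idem u) (red_idem v) (red_idem v)).
move: Hu Hv; rewrite Eu Ev => /conjugates_emb Hu /conjugates_emb Hv.
by apply/conjugates_emb/(commute_trans C0).
Qed.

(** * The candidate conjugators *)

(** Case analysis packaged as a function, a shape that the tactic [computability] recognises. *)
Definition sum_case (A B C : Type) (s : A + B) (f : A -> C) (g : B -> C) : C :=
  match s with inl a => f a | inr b => g b end.

Definition pos_prefixes (S : eqType) (w : word S) : seq (seq S) :=
  foldr (fun x qs => sum_case x
    (fun a => [::] :: foldr (fun q r => (a :: q) :: r) [::] qs)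
    (fun _ => [:: [::]])) [:: [::]] w.

Lemma pos_prefixesP (S : eqType) (q : seq S) (t : word S) :
  q \in pos_prefixes (emb q ++ t).
Proof.
elim: q => [|a q IH] /=; first by case: t => [|[]].
rewrite -/(emb q) -/(pos_prefixes _) inE; apply/orP; right.
elim: (pos_prefixes _) IH => // r rs IHr; rewrite inE => /predU1P[->|/IHr] /=.
  by rewrite inE eqxx.
by rewrite inE => ->; rewrite orbT.
Qed.

(** Reducing the quotient of the two sides leaves only the emptiness of a list to be tested. *)
Definition conjugatesb (S : eqType) (q u u' : word S) : bool :=
  nilp (red ((q ++ u) ++ winv (u' ++ q))).

Lemma conjugatesP (S : eqType) (q u u' : word S) :
  reflect (conjugates q u u') (conjugatesb q u u').
Proof.
rewrite /conjugatesb; apply: (iffP nilP) => H; last first.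
  by rewrite (red_congrr _ H) -[winv _]cats0 red_mulV.
apply: (red_cancelr (r := winv (u' ++ q))).
by rewrite H -[winv _]cats0 red_mulV.
Qed.

(** Used with [u'] and [v']: the prefixes of the first word serve the commuting case, those of the
    two products the other one. *)
Definition candidates (S : eqType) (u v : word S) : seq (seq S) :=
  pos_prefixes u ++ pos_prefixes (red (u ++ v)) ++ pos_prefixes (red (v ++ u)).

Definition conjugator (S : eqType) (u u' v v' : word S) : unit + seq S :=
  foldr (fun q r =>
    if conjugatesb (emb q) u u' then
      if conjugatesb (emb q) v v' then inr q else r
    else r) (inl tt) (candidates u' v').

Lemma conjugator_sound (S : eqType) (u u' v v' : word S) (q : seq S) :
  conjugator u u' v v' = inr q ->
  conjugates (emb q) u u' /\ conjugates (emb q) v v'.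
Proof.
rewrite /conjugator; elim: (candidates _ _) => //= r rs IH.
by case: conjugatesP => // Hu; case: conjugatesP => // Hv [<-].
Qed.

Lemma conjugator_candidates (S : eqType) (u u' v v' : word S) (q : seq S) :
  conjugates (emb q) u u' -> conjugates (emb q) v v' -> q \in candidates u' v' ->
  exists r, conjugator u u' v v' = inr r.
Proof.
rewrite /conjugator => Hu Hv; elim: (candidates _ _) => //= r rs IH.
rewrite inE => /predU1P[<-|/IH H].
  by do 2 case: conjugatesP => // _; exists q.
by do 2 (case: conjugatesP => // _); exists r.
Qed.

(* If [u] and [v] commute, suffixes [u] of [q] are stripped until [q] is a prefix
   of [u']. Otherwise [u v] and [v u] are conjugated to [u' v'] and [v' u'], and
   cannot both be suffixes of [q], having the same length. *)
Lemma conjugator_complete (S : eqType) (u u' v v' : word S) (q : seq S) :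
  u <> [::] -> reduced u -> nonneg_word u -> reduced u' -> nonneg_word v ->
  conjugates (emb q) u u' -> conjugates (emb q) v v' ->
  exists r, conjugator u u' v v' = inr r.
Proof.
move=> U0 Hu Nu Hu' Nv; case: (conjugatesP u v v) => [C|NC].
  have [n] := ubnP (size q); elim: n q => // n IH q Hn Ku Kv.
  have [[t Et]|[q1 [u0 [Eq Eu]]]] := conjugates_prefix Hu Nu Hu' Ku.
    apply: conjugator_candidates Ku Kv _; rewrite !mem_cat Et.
    by rewrite pos_prefixesP.
  rewrite Eq emb_cat -Eu in Ku Kv; apply: (IH q1).
  - apply: leq_trans (_ : size q1 < size q) _; last by rewrite -ltnS.
    by rewrite Eq size_cat -[X in X < _]addn0 ltn_add2l; case: (u0) Eu.
  - exact: conjugates_catl Ku (erefl _).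
  - exact: conjugates_catl Kv C.
move=> Ku Kv.
have Kuv := conjugates_red (erefl _) (esym (red_idem _)) (esym (red_idem _))
  (conjugates_mul Ku Kv).
have Kvu := conjugates_red (erefl _) (esym (red_idem _)) (esym (red_idem _))
  (conjugates_mul Kv Ku).
have := conjugates_prefix (red_reduced _) (nonneg_red (nonneg_cat Nu Nv))
  (red_reduced _) Kuv.
have := conjugates_prefix (red_reduced _) (nonneg_red (nonneg_cat Nv Nu))
  (red_reduced _) Kvu.
case=> [[t Et]|[q1 [x [Eq Ex]]]].
  by move=> _; apply: conjugator_candidates Ku Kv _;
    rewrite !mem_cat Et pos_prefixesP !orbT.
case=> [[t Et]|[q2 [y [Eq' Ey]]]].
  by apply: conjugator_candidates Ku Kv _;
    rewrite !mem_cat Et pos_prefixesP !orbT.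
case: NC; rewrite /conjugates Ex Ey; congr emb.
(* The balance of a positive word is its length, and [u v] and [v u] have the same balance. *)
have Exy : size x = size y.
  have := balance_red (v ++ u); have := balance_red (u ++ v).
  by rewrite Ex Ey !balance_emb !balance_cat; lia.
have Sq : size q2 = size q1.
  by have := congr1 size Eq; rewrite Eq' !size_cat Exy => /addIn.
by move: Eq'; rewrite Eq => /(congr1 (drop (size q1))); rewrite !drop_size_cat.
Qed.

(** * The solutions of the system *)

Lemma conj_eq_comparable (S : eqType) (u u' : word S) (A B : seq S) :
  u <> [::] -> reduced u -> nonneg_word u -> reduced u' -> nonneg_word u' ->
  conj_eq u u' A B -> (exists q, A = B ++ q) \/ (exists q, B = A ++ q).
Proof. by move=> U0 Hu Nu Hu' Nu' /conj_eqP; apply: conjugates_comparable. Qed.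

(** The quotient [g^-1 h] commutes with [u], so [conjugates_comparable] with [u] on both sides makes
    one of [g], [h] a prefix of the other; [c] is the remainder. *)
Lemma conjugates_comparable2 (S : eqType) (g h : seq S) (u u' : word S) :
  u <> [::] -> reduced u -> nonneg_word u ->
  conjugates (emb g) u u' -> conjugates (emb h) u u' ->
  exists c, conjugates (emb c) u u /\ (h = g ++ c \/ g = h ++ c).
Proof.
move=> U0 Hu Nu Hg Hh.
have /(conjugates_comparable U0 Hu Nu Hu Nu)[[c E]|[c E]] :
    conjugates (winv (emb g) ++ emb h) u u.
  by apply: conjugates_comp Hh _; apply/conjugates_inv.
- exists c; split; last by left.
  by rewrite E emb_cat in Hh; apply: conjugates_catr Hh Hg.
- exists c; split; last by right.
  by rewrite E emb_cat in Hg; apply: conjugates_catr Hg Hh.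
Qed.

(** Any other conjugator differs from [g] by a positive word commuting with [u], hence with [v] by
    [conjugates_trans]. *)
Lemma commuting_solutions (S : eqType) (u u' v v' : word S) (g A B : seq S) :
  u <> [::] -> reduced u -> nonneg_word u -> reduced u' -> nonneg_word u' ->
  nonneg_word v -> conjugates (emb g) u u' -> conjugates (emb g) v v' ->
  conjugates u v v -> conj_eq u u' A B -> conj_eq v v' A B.
Proof.
move=> U0 Hu Nu Hu' Nu' Nv Gu Gv C H.
have T c : conjugates (emb c) u u -> conjugates (emb c) v v.
  by move=> Hc; apply: conjugates_trans Hc C.
case: (conj_eq_comparable U0 Hu Nu Hu' Nu' H) => -[h E]; rewrite E in H *.
  move/conj_eq_catl: H => Hh; apply/conj_eq_catl.
  have [c [/T Hc [->|Eg]]] := conjugates_comparable2 U0 Hu Nu Gu Hh.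
    by rewrite emb_cat; apply: conjugates_comp Hc Gv.
  by rewrite Eg emb_cat in Gv; apply: conjugates_catl Gv Hc.
move/conj_eq_sym/conj_eq_catl: H => Hh; apply/conj_eq_sym/conj_eq_catl.
(* Here [h] leads back from [u'] to [u], so [h g] commutes with [u], and thus with [v]. *)
apply: conjugates_catl _ Gv; rewrite -emb_cat; apply: T; rewrite emb_cat.
exact: conjugates_comp Gu Hh.
Qed.

(** Two conjugators differ by a positive word commuting with both [u] and [v]; by
    [conjugates_trans_pos] it is empty. *)
Lemma noncommuting_solution (S : eqType) (u u' v v' : word S) (g A B : seq S) :
  u <> [::] -> reduced u -> nonneg_word u -> reduced u' -> nonneg_word u' ->
  nonneg_word v -> conjugates (emb g) u u' -> conjugates (emb g) v v' ->
  ~ conjugates u v v -> conj_eq u u' A B -> conj_eq v v' A B -> A = B ++ g.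
Proof.
move=> U0 Hu Nu Hu' Nu' Nv Gu Gv NC H H'.
have T c : conjugates (emb c) u u -> conjugates (emb c) v v -> c = [::].
  move=> Hc Hc'; have [//|/eqP C0] := eqVneq c [::].
  by case: NC; apply: conjugates_trans_pos Hc Hc'.
case: (conj_eq_comparable U0 Hu Nu Hu' Nu' H) => -[h E]; rewrite E in H H' *.
  move/conj_eq_catl: H => Hu1; move/conj_eq_catl: H' => Hv1; congr (_ ++ _).
  have [c [Hc [Eh|Eg]]] := conjugates_comparable2 U0 Hu Nu Gu Hu1.
    rewrite Eh emb_cat in Hv1; rewrite Eh (T c) ?cats0 //.
    exact: conjugates_catr Hv1 Gv.
  rewrite Eg emb_cat in Gv; rewrite Eg (T c) ?cats0 //.
  exact: conjugates_catr Gv Hv1.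
move/conj_eq_sym/conj_eq_catl: H => Hu1; move/conj_eq_sym/conj_eq_catl: H' => Hv1.
(* If [B = A h], then [h g] commutes with [u] and [v], which forces [A = B] and an empty [g]. *)
have : h ++ g = [::].
  by apply: T; rewrite emb_cat; [apply: conjugates_comp Gu Hu1 |
    apply: conjugates_comp Gv Hv1].
by rewrite -catA => ->; rewrite cats0.
Qed.

Lemma conjugator_solves (S : eqType) (u u' v v' : word S) (q A B : seq S) :
  u <> [::] -> reduced u -> nonneg_word u -> reduced u' -> nonneg_word u' ->
  nonneg_word v -> conjugator u u' v v' = inr q ->
  (conj_eq u u' A B /\ conj_eq v v' A B) <->
  (if conjugatesb u v v then conj_eq u u' A B else A = B ++ q).
Proof.
move=> U0 Hu Nu Hu' Nu' Nv /conjugator_sound[Gu Gv].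
case: conjugatesP => [C|NC].
  by split=> [[]//|H]; split=> //; apply: commuting_solutions Gu Gv C H.
split=> [[H H']|->]; first exact: noncommuting_solution Gu Gv NC H H'.
by split; apply/conj_eq_catl.
Qed.

Lemma conjugates_nonempty (S : eqType) (q u u' : word S) :
  reduced u -> conjugates q u u' -> u <> [::] -> u' <> [::].
Proof.
move=> Hu H U0 E; apply: U0; rewrite -(red_id Hu).
by have /red_cancell : red (q ++ u) = red (q ++ [::]) by rewrite H E cats0.
Qed.

Lemma conj_eq_nil (S : eqType) (A B : seq S) : conj_eq [::] [::] A B.
Proof. by apply/conj_eqP; rewrite /conjugates cats0. Qed.

(** The first search looks for a positive [B^-1 A], the second one, with the sides exchanged, for a
    positive [A^-1 B]. When [u] and [v] commute, one common solution makes the second equation a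
    consequence of the first. *)
Definition solve (S : eqType) (x : (word S * word S) * (word S * word S)) :
    equiv_form S :=
  let: ((u, u'), (v, v')) := x in
  if nilp u then if nilp u' then Single v v' else Contradictory
  else match conjugator u u' v v' with
    | inr q => if conjugatesb u v v then Single u u' else SolvedA q
    | inl _ =>
      match conjugator u' u v' v with
      | inr q => if conjugatesb u v v then Single u u' else SolvedB q
      | inl _ => Contradictory
      end
    end.

Lemma solve_correct (S : eqType) (u u' v v' : word S) (A B : seq S) :
  reduced u -> reduced u' -> nonneg_word u -> nonneg_word u' ->
  nonneg_word v -> nonneg_word v' ->
  (conj_eq u u' A B /\ conj_eq v v' A B) <->
  satisfies (solve ((u, u'), (v, v'))) A B.
Proof.
move=> Hu Hu' Nu Nu' Nv Nv'; rewrite /solve; case: nilP => [->|U0].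
  case: nilP => [->|U0'] /=; first by split=> [[]//|H]; split=> //; apply: conj_eq_nil.
  split=> // -[/conj_eq_sym/conj_eqP K _].
  exact: conjugates_nonempty K U0' (erefl _).
have Cmp := conj_eq_comparable U0 Hu Nu Hu' Nu'.
case E: (conjugator u u' v v') => [?|q]; last first.
  by rewrite (conjugator_solves _ _ U0 Hu Nu Hu' Nu' Nv E); case: conjugatesb.
case E': (conjugator u' u v' v) => [?|q] /=.
  (* A solution would yield a positive conjugator in one direction, which the corresponding search
     could not miss. *)
  split=> // -[H H']; case: (Cmp _ _ H) => -[q Eq]; rewrite Eq in H H'.
    move/conj_eq_catl: H => K; move/conj_eq_catl: H' => K'.
    by have [r] := conjugator_complete U0 Hu Nu Hu' Nv K K'; rewrite E.
  move/conj_eq_sym/conj_eq_catl: H => K; move/conj_eq_sym/conj_eq_catl: H' => K'.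
  have U0' : u' <> [::] by move/conjugates_inv: K => /conjugates_nonempty; exact.
  by have [r] := conjugator_complete U0' Hu' Nu' Hu Nv' K K'; rewrite E'.
have [K K'] := conjugator_sound E'.
have U0' : u' <> [::] by move/conjugates_inv: K => /conjugates_nonempty; exact.
(* The exchanged form of [conjugator_solves] tests [u'] and [v']; commutation is invariant under
   conjugation by [q]. *)
have -> : conjugatesb u v v = conjugatesb u' v' v'.
  apply/conjugatesP/conjugatesP => C; last exact: conjugates_commute K K' C.
  by move/conjugates_inv: K => K; move/conjugates_inv: K' => K';
    apply: conjugates_commute K K' C.
have := conjugator_solves B A U0' Hu' Nu' Hu Nu Nv' E'.
have := conj_eq_sym u' u B A; have := conj_eq_sym v' v B A.
have : B = A ++ q <-> A ++ q = B by split=> ->.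
by case: conjugatesb => /=; tauto.
Qed.

(** * Computability *)

(** The parameter slot of [c_case] receives the whole argument [x], so that the branches may depend
    on it. *)
Lemma computable_sum_case (S : eqType) (X A B C : Type) (s : X -> A + B)
    (f : X -> A -> C) (g : X -> B -> C) :
  computable S s -> computable S (fun p => f p.1 p.2) ->
  computable S (fun p => g p.1 p.2) ->
  computable S (fun x => sum_case (s x) (f x) (g x)).
Proof.
move=> Hs Hf Hg.
exact: c_ext (c_comp (c_case Hf Hg) (c_pair (c_id S X) Hs)) (fun=> erefl _).
Qed.

Lemma computable_foldr (S : eqType) (X A B : Type) (f : X -> A -> B -> B)
    (z : X -> B) (s : X -> seq A) :
  computable S (fun p => f p.1 p.2.1 p.2.2) -> computable S z ->
  computable S s -> computable S (fun x => foldr (f x) (z x) (s x)).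
Proof.
move=> Hf Hz Hs.
exact: c_ext (c_comp (c_foldr Hf) (c_pair (c_id S X) (c_pair Hz Hs)))
  (fun=> erefl _).
Qed.

Create HintDb computability.
#[local] Hint Resolve c_eq c_fst c_snd c_inl c_inr c_cons : computability.

(** Recursion on the syntax of the function body; functions of several arguments are uncurried to
    nested pairs and looked up in the hint database. *)
Ltac computability :=
  cbv beta;
  match goal with
  | |- computable _ (fun x => x) => apply: c_id
  | |- computable _ (fun _ => tt) => apply: c_unit
  | |- computable _ (fun _ => true) => apply: c_bool
  | |- computable _ (fun _ => false) => apply: c_bool
  | |- computable _ (fun _ => [::]) => apply: c_nil
  | |- computable ?S (fun x => (@?f x, @?g x)) =>
      refine (@c_pair S _ _ _ f g _ _); computability
  | |- computable ?S (fun x => @?f x :: @?g x) =>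
      refine (@c_comp S _ _ _ _ (fun x => (f x, g x)) (c_cons S _) _);
      computability
  | |- computable ?S (fun x => match @?c x with true => @?f x | false => @?g x end) =>
      refine (@c_if S _ _ c f g _ _ _); computability
  | |- computable ?S (fun x => sum_case (@?s x) (@?f x) (@?g x)) =>
      refine (@computable_sum_case S _ _ _ _ s f g _ _ _); computability
  | |- computable ?S (fun x => foldr (@?f x) (@?z x) (@?s x)) =>
      refine (@computable_foldr S _ _ _ f z s _ _ _); computability
  | |- computable ?S (fun x => ?g (@?f x) (@?h x) (@?k x) (@?l x)) =>
      refine (@c_comp S _ _ _ (fun p => g p.1.1 p.1.2 p.2.1 p.2.2)
                (fun x => ((f x, h x), (k x, l x))) _ _);
      [solve [auto with computability] | computability]
  | |- computable ?S (fun x => ?g (@?f x) (@?h x) (@?k x)) =>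
      refine (@c_comp S _ _ _ (fun p => g p.1 p.2.1 p.2.2)
                (fun x => (f x, (h x, k x))) _ _);
      [solve [auto with computability] | computability]
  | |- computable ?S (fun x => ?g (@?f x) (@?h x)) =>
      refine (@c_comp S _ _ _ (fun p => g p.1 p.2) (fun x => (f x, h x)) _ _);
      [solve [auto with computability] | computability]
  | |- computable ?S (fun x => ?g (@?f x)) =>
      refine (@c_comp S _ _ _ g f _ _);
      [solve [auto with computability] | computability]
  end.

Lemma computable_cat (S : eqType) (A : Type) :
  computable S (fun p : seq A * seq A => p.1 ++ p.2).
Proof.
apply: (c_ext (f := fun p => foldr (fun a b => a :: b) p.2 p.1)).
  computability.
by case=> s t /=; elim: s => //= a s ->.
Qed.
#[local] Hint Resolve computable_cat : computability.

(** [computable] has no case analysis on lists, so it is derived from [foldr]: the accumulator is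
    the decomposed tail, from which the tail itself is rebuilt. *)
Definition uncons (A : Type) (s : seq A) : unit + A * seq A :=
  foldr (fun a r => inr (a, sum_case r (fun _ => [::]) (fun b => b.1 :: b.2)))
    (inl tt) s.

Lemma unconsE (A : Type) (s : seq A) :
  uncons s = if s is a :: t then inr (a, t) else inl tt.
Proof. by elim: s => // a s /=; rewrite -/(uncons s) => ->; case: s. Qed.

Lemma computable_uncons (S : eqType) (A : Type) : computable S (@uncons A).
Proof. rewrite /uncons; computability. Qed.
#[local] Hint Resolve computable_uncons : computability.

Lemma computable_nilp (S : eqType) (A : Type) : computable S (@nilp A).
Proof.
apply: (c_ext (f := fun s => foldr (fun _ _ => false) true s)).
  computability.
by case.
Qed.
#[local] Hint Resolve computable_nilp : computability.

Lemma computable_linv (S : eqType) : computable S (@linv S).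
Proof.
apply: (c_ext (f := fun x => sum_case x (fun a => inr a) (fun a => inl a))).
  computability.
by case.
Qed.
#[local] Hint Resolve computable_linv : computability.

Lemma computable_letter_eq (S : eqType) :
  computable S (fun p : letter S * letter S => p.1 == p.2).
Proof.
apply: (c_ext (f := fun p : letter S * letter S => sum_case p.1
  (fun a => sum_case p.2 (fun b => a == b) (fun _ => false))
  (fun a => sum_case p.2 (fun _ => false) (fun b => a == b)))).
  computability.
by case=> -[] a [].
Qed.
#[local] Hint Resolve computable_letter_eq : computability.

Lemma computable_push (S : eqType) :
  computable S (fun p : letter S * word S => push p.1 p.2).
Proof.
apply: (c_ext (f := fun p : letter S * word S => sum_case (uncons p.2)
  (fun _ => [:: p.1])
  (fun yt => if yt.1 == linv p.1 then yt.2 else p.1 :: p.2))).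
  computability.
by case=> x w; rewrite unconsE; case: w.
Qed.
#[local] Hint Resolve computable_push : computability.

Lemma computable_red (S : eqType) : computable S (@red S).
Proof. rewrite /red; computability. Qed.
#[local] Hint Resolve computable_red : computability.

Lemma computable_winv (S : eqType) : computable S (@winv S).
Proof.
apply: (c_ext (f := fun w => foldr (fun x t => t ++ [:: linv x]) [::] w)).
  computability.
by elim=> //= x w ->; rewrite winv_cons.
Qed.
#[local] Hint Resolve computable_winv : computability.

Lemma computable_emb (S : eqType) : computable S (@emb S).
Proof.
apply: (c_ext (f := fun w => foldr (fun x t => inl x :: t) [::] w)).
  computability.
by elim=> //= x w ->.
Qed.
#[local] Hint Resolve computable_emb : computability.

Lemma computable_pos_prefixes (S : eqType) : computable S (@pos_prefixes S).
Proof. rewrite /pos_prefixes; computability. Qed.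
#[local] Hint Resolve computable_pos_prefixes : computability.

Lemma computable_conjugatesb (S : eqType) :
  computable S (fun p : word S * (word S * word S) =>
    conjugatesb p.1 p.2.1 p.2.2).
Proof. rewrite /conjugatesb; computability. Qed.
#[local] Hint Resolve computable_conjugatesb : computability.

Lemma computable_candidates (S : eqType) :
  computable S (fun p : word S * word S => candidates p.1 p.2).
Proof. rewrite /candidates; computability. Qed.
#[local] Hint Resolve computable_candidates : computability.

Lemma computable_conjugator (S : eqType) :
  computable S (fun p : (word S * word S) * (word S * word S) =>
    conjugator p.1.1 p.1.2 p.2.1 p.2.2).
Proof. rewrite /conjugator; computability. Qed.
#[local] Hint Resolve computable_conjugator : computability.

Lemma computable_solve (S : eqType) :
  computable S (fun x : (word S * word S) * (word S * word S) =>
    equiv_form_code (solve x)).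
Proof.
pose W := word S; pose code := ((seq S + seq S) + (W * W + unit))%type.
(* This is [solve] with the encoding pushed into the branches and the matches expressed by
   [sum_case]. *)
apply: (c_ext (f := fun x : (W * W) * (W * W) =>
  if nilp x.1.1 then
    if nilp x.1.2 then inr (inl x.2) else inr (inr tt)
  else sum_case (conjugator x.1.1 x.1.2 x.2.1 x.2.2)
    (fun _ => sum_case (conjugator x.1.2 x.1.1 x.2.2 x.2.1)
      (fun _ => inr (inr tt))
      (fun q => if conjugatesb x.1.1 x.2.1 x.2.1 then inr (inl x.1)
                else inl (inl q)))
    (fun q => if conjugatesb x.1.1 x.2.1 x.2.1 then inr (inl x.1)
              else inl (inr q)) : code)).
  computability.
case=> [[u u'] [v v']]; rewrite /solve /=.
case: nilp; first by case: nilp.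
case: conjugator => [_|q] /=; last by case: conjugatesb.
by case: conjugator => [_|q] //=; case: conjugatesb.
Qed.

Theorem theorem10 (S : eqType) :
  exists F : (word S * word S) * (word S * word S) -> equiv_form S,
    computable S (fun x => equiv_form_code (F x)) /\
    forall u u' v v' : word S,
      maximally_cancelled u -> maximally_cancelled u' ->
      balance u = balance u' -> (0 <= balance u)%R ->
      nonneg_word u -> nonneg_word u' -> nonneg_word v -> nonneg_word v' ->
      balance v = balance v' ->
      admissible (F ((u, u'), (v, v'))) /\
      forall A B : seq S,
        (conj_eq u u' A B /\ conj_eq v v' A B) <->
        satisfies (F ((u, u'), (v, v'))) A B.
Proof.
exists (@solve S); split; first exact: computable_solve.
move=> u u' v v' Mu Mu' Bu _ Nu Nu' Nv Nv' Bv; split; last first.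
  by move=> A B; apply: solve_correct => //; apply: maximally_cancelled_reduced.
(* A [Single] output is always one of the two given equations, so it inherits their hypotheses. *)
rewrite /solve; case: nilp; first by case: nilp.
case: conjugator => [_|q]; last by case: conjugatesb.
by case: conjugator => [_|q] //; case: conjugatesb.
Qed.
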